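(* Let $n\geq 3$ and let $M$ be a connected holomorphic h-umbilical hypersurface in $(\mathbb{R}^{2n+2},g,J)$. Then $M$ is contained in an h-sphere or in a holomorphic hyperplane.
   Context: On $\mathbb{R}^{2n+2}$ with points $Z=(x^1,\dots,x^{n+1};y^1,\dots,y^{n+1})$, let $J(x;y)=(y;-x)$, $g(Z,W)=\sum_k x_Z^kx_W^k-\sum_k y_Z^ky_W^k$, $\tilde g(Z,W)=g(JZ,W)$; this is a flat Kähler manifold with Norden metric ($g(JZ,JW)=-g(Z,W)$, $\nabla'J=0$ for the flat connection $\nabla'$). A holomorphic hypersurface is a $2n$-dimensional submanifold $M$ with $J(T_pM)=T_pM$ and $g|_{T_pM}$ nondegenerate for all $p$; with induced Levi-Civita connection $\nabla$, its second fundamental form $\sigma$ is defined by $\nabla'_XY=\nabla_XY+\sigma(X,Y)$, and its mean curvature vector is $H=\frac{1}{2n}\operatorname{trace}_g\sigma$. $M$ is h-umbilical if at every point $\sigma(x,y)=g(x,y)H-\tilde g(x,y)JH$ for all tangent $x,y$. For $z_0$ with position vector $Z_0$ and $(a,b)\neq(0,0)$, the h-sphere $S^{2n}(z_0;a,b)=\{Z: g(Z-Z_0,Z-Z_0)=a,\ \tilde g(Z-Z_0,Z-Z_0)=b\}$. A holomorphic hyperplane is an affine subspace $Z_0+W$ with $W$ a $J$-invariant $2n$-dimensional linear subspace on which $g$ is nondegenerate. *)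

(* Defs.v *)
From HB Require Import structures.
From mathcomp Require Import all_boot all_order all_algebra.
From mathcomp Require Import all_classical all_reals all_analysis.
Set Implicit Arguments. Unset Strict Implicit. Unset Printing Implicit Defensive.
Import Order.TTheory GRing.Theory Num.Theory.
Import numFieldNormedType.Exports.
Local Open Scope classical_set_scope.
Local Open Scope ring_scope.

Section Norden.
Variable R : realType.
Variable n : nat.

(* ambient space R^{2n+2}, coordinates (x^1..x^{n+1}; y^1..y^{n+1}) *)
Local Notation amb := 'rV[R]_(n.+1 + n.+1).
Local Notation par := 'rV[R]_(n + n).

(* J(x;y) = (y;-x), as right multiplication by a block matrix *)
Definition Jmx : 'M[R]_(n.+1 + n.+1) := block_mx 0 (- 1%:M) 1%:M 0.
Definition Jv (Z : amb) : amb := Z *m Jmx.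

Definition gform (Z W : amb) : R :=
  \sum_(k < n.+1) (lsubmx Z 0 k * lsubmx W 0 k)
  - \sum_(k < n.+1) (rsubmx Z 0 k * rsubmx W 0 k).
Definition gtilde (Z W : amb) : R := gform (Jv Z) W.

Fixpoint Diter (s : seq par) (f : par -> amb) : par -> amb :=
  match s with
  | [::] => f
  | v :: s' => fun x => derive (Diter s' f) x v
  end.

Definition smooth_on (A : set par) (f : par -> amb) :=
  forall (s : seq par) (x : par), A x -> differentiable (Diter s f) x.

Definition ee (i : 'I_(n + n)) : par := delta_mx 0 i.

Definition Tmx (phi : par -> amb) (u : par) : 'M[R]_(n + n, n.+1 + n.+1) :=
  \matrix_(i, k) (derive phi u (ee i)) 0 k.

(* second derivatives d_i d_j phi (u) = nabla'_{d_i} d_j phi *)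
Definition d2 (phi : par -> amb) (i j : 'I_(n + n)) (u : par) : amb :=
  derive (fun w => derive phi w (ee j)) u (ee i).

Definition gram m (T : 'M[R]_(m, n.+1 + n.+1)) : 'M[R]_m :=
  \matrix_(i, j) gform (row i T) (row j T).

(* local parametrization (chart) of the embedded 2n-dim submanifold M:
   phi : U -> M `&` W smooth immersive homeomorphism onto an open piece of M *)
Definition is_chart (M : set amb) (U : set par) (W : set amb) (phi : par -> amb) :=
  open U /\ open W /\ smooth_on U phi /\
  (forall u v, U u -> U v -> phi u = phi v -> u = v) /\
  phi @` U = M `&` W /\
  (forall V, open V -> V `<=` U -> exists W', open W' /\ phi @` V = M `&` W') /\
  (forall u, U u -> row_free (Tmx phi u)).

Definition submanifold (M : set amb) :=
  forall p, M p -> exists U W phi, is_chart M U W phi /\ W p.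

Definition holomorphic_hypersurface (M : set amb) :=
  submanifold M /\
  forall U W phi, is_chart M U W phi -> forall u, U u ->
    (Tmx phi u *m Jmx == Tmx phi u)%MS /\ \det (gram (Tmx phi u)) != 0.

(* g-orthogonal projection onto the normal space of M at phi u *)
Definition nor (phi : par -> amb) (u : par) (v : amb) : amb :=
  let T := Tmx phi u in
  v - \sum_(i < n + n)
        (\sum_(j < n + n) gform v (row j T) * invmx (gram T) j i) *: row i T.

(* second fundamental form sigma(a T, b T) for tangent vectors given by
   coefficient rows a, b in the coordinate basis *)
Definition sigma (phi : par -> amb) (u : par) (a b : par) : amb :=
  \sum_(i < n + n) \sum_(j < n + n) (a 0 i * b 0 j) *: nor phi u (d2 phi i j u).

(* mean curvature vector H = 1/(2n) trace_g sigma *)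
Definition Hmean (phi : par -> amb) (u : par) : amb :=
  ((n + n)%:R)^-1 *: \sum_(i < n + n) \sum_(j < n + n)
     invmx (gram (Tmx phi u)) i j *: nor phi u (d2 phi i j u).

Definition h_umbilical (M : set amb) :=
  forall U W phi, is_chart M U W phi -> forall u, U u ->
    forall a b : par,
      let x := a *m Tmx phi u in let y := b *m Tmx phi u in
      sigma phi u a b = gform x y *: Hmean phi u - gtilde x y *: Jv (Hmean phi u).

Definition h_sphere (Z0 : amb) (a b : R) : set amb :=
  [set Z | gform (Z - Z0) (Z - Z0) = a /\ gtilde (Z - Z0) (Z - Z0) = b].

Definition holomorphic_hyperplane (P : set amb) :=
  exists (Z0 : amb) (Wm : 'M[R]_(n + n, n.+1 + n.+1)),
    [/\ row_free Wm, (Wm *m Jmx == Wm)%MS, \det (gram Wm) != 0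
      & P = [set Z | exists c : par, Z = Z0 + c *m Wm]].

End Norden.

(* Main.v *)
Require Import Defs.
From HB Require Import structures.
From mathcomp Require Import all_boot all_order all_algebra.
From mathcomp Require Import all_classical all_reals all_analysis.
From mathcomp Require Import ring zify.
Set Implicit Arguments. Unset Strict Implicit. Unset Printing Implicit Defensive.
Import Order.TTheory GRing.Theory Num.Theory.
Import numFieldNormedType.Exports.
Local Open Scope classical_set_scope.
Local Open Scope ring_scope.

(** Write [G = g + i g~], a bilinear form that is complex linear when [J] acts as
    multiplication by [-i]; umbilicity then reads [sigma (x, y) = G (x, y) H], and
    the normal spaces are complex lines on which [G] is nondegenerate.

    Put [c = G (H, H)].  Differentiating [G (d_i d_j phi, H) = G_ij c] along [d_k]
    and using the symmetry of third derivatives gives [G_ij d_k c = G_kj d_i c].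
    As [n >= 2], for every [k] some tangent vector is [G]-orthogonal to [d_k phi],
    hence [c] is locally constant.  If [c <> 0] then [d_k H = - c d_k phi], so
    [phi + H / c] is the constant centre of an h-sphere.  If [c = 0] then [H = 0],
    the orthogonal projection onto the normal space is constant, and [phi] stays
    in an affine complex hyperplane.

    An h-sphere or hyperplane containing a germ of [M] is determined by that germ
    (the cases are told apart by [H], and the tangent plane or the normal line
    fixes the rest), so the points of [M] having a given germ form an open and
    closed subset. *)

(** * Linear algebra of the Norden metric *)

Section NordenAlgebra.
Variables (R : realType) (n : nat).
Local Notation amb := 'rV[R]_(n.+1 + n.+1).
Local Notation J := (@Jv R n).
Local Notation g := (@gform R n).
Implicit Types (v w z Z W : amb) (m : nat).

Definition gmx : 'M[R]_(n.+1 + n.+1) := block_mx 1%:M 0 0 (- 1%:M).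

Lemma gformE Z W : g Z W = (Z *m gmx *m W^T) 0 0.
Proof.
rewrite /gform /gmx -{3}(hsubmxK Z) -{3}(hsubmxK W) mul_row_block !mulmx0.
rewrite addr0 add0r mulmx1 mulmxN mulmx1 tr_row_mx mul_row_col mulNmx !mxE.
by congr (_ - _); apply: eq_bigr => k _; rewrite !mxE.
Qed.

Lemma gformC Z W : g Z W = g W Z.
Proof. by rewrite /gform; congr (_ - _); apply: eq_bigr => k _; rewrite mulrC. Qed.

Lemma gformDl Z1 Z2 W : g (Z1 + Z2) W = g Z1 W + g Z2 W.
Proof. by rewrite !gformE !mulmxDl mxE. Qed.

Lemma gformZl a Z W : g (a *: Z) W = a * g Z W.
Proof. by rewrite !gformE -!scalemxAl mxE. Qed.

Lemma gformNl Z W : g (- Z) W = - g Z W.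
Proof. by rewrite !gformE !mulNmx mxE. Qed.

Lemma gformDr Z W1 W2 : g Z (W1 + W2) = g Z W1 + g Z W2.
Proof. by rewrite ![g Z _]gformC gformDl. Qed.

Lemma gformZr a Z W : g Z (a *: W) = a * g Z W.
Proof. by rewrite ![g Z _]gformC gformZl. Qed.

Lemma gformNr Z W : g Z (- W) = - g Z W.
Proof. by rewrite ![g Z _]gformC gformNl. Qed.

Lemma gform0l Z : g 0 Z = 0.
Proof. by rewrite gformE !mul0mx mxE. Qed.

Lemma gform0r Z : g Z 0 = 0.
Proof. by rewrite gformC gform0l. Qed.

Definition gformL := (gformDl, gformDr, gformNl, gformNr, gformZl, gformZr).

Lemma JvK Z : J (J Z) = - Z.
Proof.
rewrite /Jv /Jmx -mulmxA mulmx_block !mulmx0 !mul0mx !mulmx1 mul1mx !addr0 !add0r.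
by rewrite -raddfN -scalar_mx_block mul_mx_scalar scaleN1r.
Qed.

Lemma JvD Z W : J (Z + W) = J Z + J W.
Proof. exact: mulmxDl. Qed.

Lemma JvN Z : J (- Z) = - J Z.
Proof. exact: mulNmx. Qed.

Lemma JvZ a Z : J (a *: Z) = a *: J Z.
Proof. by rewrite /Jv -scalemxAl. Qed.

Definition JvL := (JvD, JvN, JvZ, JvK).

Lemma gform_J Z W : g (J Z) W = g Z (J W).
Proof.
rewrite !gformE /Jv trmx_mul !mulmxA.
suff -> : Z *m Jmx R n *m gmx = Z *m gmx *m (Jmx R n)^T by [].
rewrite -!mulmxA; congr (_ *m _).
rewrite /Jmx /gmx tr_block_mx !mulmx_block !(mulmx0, mul0mx, trmx0, trmx1).
rewrite !(mulmx1, mul1mx, mulmxN, mulNmx, addr0, add0r, opprK, trmx1).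
by rewrite linearN /= trmx1 !(mulmx1, mul1mx, mulmxN, mulNmx, addr0, add0r, opprK, trmx1).
Qed.

Lemma gform_JJ Z W : g (J Z) (J W) = - g Z W.
Proof. by rewrite gform_J JvK gformNr. Qed.

Lemma gmx_unit : gmx \in unitmx.
Proof.
rewrite unitmxE det_ublock det1 mul1r -scaleN1r detZ det1 mulr1 unitrX //.
by rewrite unitrN1.
Qed.

Lemma gform_nondeg w : (forall Z, g w Z = 0) -> w = 0.
Proof.
move=> h; have: w *m gmx = 0.
  apply/rowP => k; rewrite [RHS]mxE -(h (delta_mx 0 k)) gformE trmx_delta.
  by rewrite -colE [RHS]mxE.
by move/(congr1 (mulmx^~ (invmx gmx))); rewrite mulmxK ?gmx_unit // mul0mx.
Qed.

(** Applying [a + b J] to [a v - b J v] gives [(a^2 + b^2) v], because [J] squares to [-1]: a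
    nonzero complex scalar is invertible. *)
Lemma linJ_eq0 v a b : v != 0 -> a *: v - b *: J v = 0 -> a = 0 /\ b = 0.
Proof.
move=> v0 E; have: (a ^+ 2 + b ^+ 2) *: v = 0.
  transitivity (a *: (a *: v - b *: J v) + b *: J (a *: v - b *: J v)).
    by rewrite !JvL scalerBr scalerBr scalerN !scalerA; apply/rowP=> i; rewrite !mxE; ring.
  by rewrite E /Jv mul0mx !scaler0 addr0.
move/eqP; rewrite scaler_eq0 (negPf v0) orbF paddr_eq0 ?sqr_ge0 // !sqrf_eq0.
by case/andP => /eqP -> /eqP ->.
Qed.

Lemma gram_mulmx m (T : 'M[R]_(m, n.+1 + n.+1)) : gram T = T *m gmx *m T^T.
Proof.
apply/matrixP => i j; rewrite mxE gformE -row_mul -row_mul !mxE.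
by apply: eq_bigr => k _; rewrite !mxE.
Qed.

Lemma gform_row_mul m (T : 'M[R]_(m, n.+1 + n.+1)) v (c : 'rV[R]_m) :
  g v (c *m T) = \sum_i c 0 i * g v (row i T).
Proof.
rewrite mulmx_sum_row; elim/big_rec2: _ => [|i x y _ <-]; first exact: gform0r.
by rewrite gformDr gformZr.
Qed.

Lemma gform_rows m (T : 'M[R]_(m, n.+1 + n.+1)) v :
  v *m gmx *m T^T = \row_i g v (row i T).
Proof.
apply/rowP => i; rewrite !mxE gformE !mxE; apply: eq_bigr => k _.
by rewrite !mxE.
Qed.

(** The matrix form of [nor], for an arbitrary matrix [T]; as a product of matrices it can be
    cancelled against [gram T] and differentiated factor by factor. *)
Definition normal_part m (T : 'M[R]_(m, n.+1 + n.+1)) v : amb :=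
  v - v *m gmx *m T^T *m invmx (gram T) *m T.

(** Orthogonality to [z] and [J z] amounts to two linear equations in [n + n > 2] unknowns, so a
    nonzero coefficient row exists; independence of the rows of [T] keeps the resulting vector
    nonzero. *)
Lemma tangent_orthogonal (T : 'M[R]_(n + n, n.+1 + n.+1)) z : (1 < n)%N -> row_free T ->
  exists c, [/\ c *m T != 0, g z (c *m T) = 0 & gtilde z (c *m T) = 0].
Proof.
move=> n1 Tf; pose K := T *m gmx *m (col_mx z (J z))^T.
have : kermx K != 0.
  rewrite kermx_eq0 /row_free.
  by have := rank_leq_col K; set r := \rank K; move=> ?; apply/negP => /eqP; lia.
case/rowV0Pn => c /sub_kermxP cK c0; exists c; split.
- apply: contraNneq c0 => E; apply/eqP; apply: (row_free_inj Tf).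
  by rewrite E mul0mx.
- move: cK; rewrite /K !mulmxA tr_col_mx mul_mx_row => /(congr1 lsubmx).
  rewrite row_mxKl gformC gformE => ->; by rewrite !mxE.
- move: cK; rewrite /K !mulmxA tr_col_mx mul_mx_row => /(congr1 rsubmx).
  rewrite row_mxKr /gtilde gformC gformE => ->; by rewrite !mxE.
Qed.

Section Tangent.
Variable T : 'M[R]_(n + n, n.+1 + n.+1).
Hypothesis TJ : (T *m Jmx R n == T)%MS.
Hypothesis Tg : \det (gram T) != 0.
Local Notation norm := (normal_part T).

Definition is_normal v := forall i, g (row i T) v = 0.

Lemma gram_unit : gram T \in unitmx.
Proof. by rewrite unitmxE unitfE. Qed.

Lemma tangent_J (c : 'rV[R]_(n + n)) : exists d, J (c *m T) = d *m T.
Proof.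
case/andP: TJ => /submxP [D E] _; exists (c *m D).
by rewrite /Jv -mulmxA E mulmxA.
Qed.

Lemma normal_tangent v (c : 'rV[R]_(n + n)) : is_normal v -> g (c *m T) v = 0.
Proof.
move=> nv; rewrite gformC gform_row_mul big1 // => i _.
by rewrite gformC nv mulr0.
Qed.

Lemma is_normalJ v : is_normal v -> is_normal (J v).
Proof.
move=> nv i; rewrite -gform_J rowE; have [d ->] := tangent_J (delta_mx 0 i).
exact: normal_tangent.
Qed.

Lemma is_normalD v w : is_normal v -> is_normal w -> is_normal (v + w).
Proof. by move=> nv nw i; rewrite gformDr nv nw addr0. Qed.

Lemma is_normalN v : is_normal v -> is_normal (- v).
Proof. by move=> nv i; rewrite gformNr nv oppr0. Qed.

Lemma is_normalZ a v : is_normal v -> is_normal (a *: v).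
Proof. by move=> nv i; rewrite gformZr nv mulr0. Qed.

Lemma tangent_nondeg (c : 'rV[R]_(n + n)) :
  (forall i, g (row i T) (c *m T) = 0) -> c = 0.
Proof.
move=> h; have: c *m gram T = 0.
  rewrite gram_mulmx !mulmxA gform_rows; apply/rowP => i.
  by rewrite !mxE gformC h.
by move/(congr1 (mulmx^~ (invmx (gram T)))); rewrite mulmxK ?gram_unit // mul0mx.
Qed.

(** With [x = c *m T], invariance under [J] makes [a x - b J x] tangent, and it is orthogonal to
    every tangent vector. Thus a complex factor of [G (_, x)] vanishes as soon as the real parts of
    all the products do. *)
Lemma tangent_linJ_eq0 (c : 'rV[R]_(n + n)) a b : c *m T != 0 ->
  (forall i, a * g (row i T) (c *m T) - b * gtilde (row i T) (c *m T) = 0) ->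
  a = 0 /\ b = 0.
Proof.
move=> c0 h; apply: (@linJ_eq0 (c *m T)) => //.
have [d E] := tangent_J c.
have -> : a *: (c *m T) - b *: J (c *m T) = (a *: c - b *: d) *m T.
  by rewrite E mulmxBl -!scalemxAl.
rewrite (@tangent_nondeg (a *: c - b *: d)) ?mul0mx // => i.
rewrite mulmxBl -!scalemxAl -E !gformL -gform_J; exact: h.
Qed.

Lemma normal_partP v : exists c, v = c *m T + norm v.
Proof.
by exists (v *m gmx *m T^T *m invmx (gram T)); rewrite /normal_part addrC subrK.
Qed.

Lemma normal_part_normal v : is_normal (norm v).
Proof.
move=> i; rewrite gformC.
have: norm v *m gmx *m T^T = 0.
  rewrite /normal_part 2!mulmxBl -!mulmxA (mulmxA T) -gram_mulmx mulVmx ?gram_unit //.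
  by rewrite mulmx1 subrr.
by rewrite gform_rows => /rowP/(_ i); rewrite !mxE.
Qed.

Lemma normal_part_tangent (c : 'rV[R]_(n + n)) : norm (c *m T) = 0.
Proof.
rewrite /normal_part -(mulmxA c) -(mulmxA c) -gram_mulmx mulmxK ?gram_unit //.
by rewrite subrr.
Qed.

Lemma gform_normal_part v w : is_normal w -> g (norm v) w = g v w.
Proof.
move=> nw; have [c E] := normal_partP v.
transitivity (g (c *m T + norm v) w); last by rewrite -E.
by rewrite [RHS]gformDl normal_tangent // add0r.
Qed.

(** The tangent part of any ambient vector is orthogonal to [w], so nondegeneracy passes from the
    ambient space to the normal space. *)
Lemma normal_normal0 w : is_normal w -> (forall v, is_normal v -> g v w = 0) -> w = 0.
Proof.
move=> nw h; apply: gform_nondeg => Z; have [c ->] := normal_partP Z.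
rewrite gformC gformDl normal_tangent // add0r h //; exact: normal_part_normal.
Qed.

(* [T], [v] and [J v] together span the ambient space. *)
Lemma normal_line v w : is_normal v -> is_normal w -> v != 0 ->
  g v w = 0 -> g (J v) w = 0 -> w = 0.
Proof.
move=> nv nw v0 vw Jvw.
pose B := col_mx T (col_mx v (J v)).
have Bfree : row_free B.
  rewrite -kermx_eq0; apply/rowV0P => c.
  move/sub_kermxP; rewrite -(hsubmxK c) -(hsubmxK (rsubmx c)).
  set a := lsubmx c; set b := lsubmx _; set d := rsubmx (rsubmx _).
  rewrite /B !mul_row_col => E.
  have a0 : a = 0.
    apply: tangent_nondeg => i.
    have -> : a *m T = - (b *m v + d *m J v).
      by apply/eqP; rewrite -subr_eq0 opprK E.
    rewrite (mx11_scalar b) (mx11_scalar d) !mul_scalar_mx !gformL nv.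
    by rewrite (is_normalJ nv) !mulr0 addr0 oppr0.
  move: E; rewrite a0 mul0mx add0r {1}(mx11_scalar b) {1}(mx11_scalar d).
  rewrite !mul_scalar_mx -[_ *: J v]opprK -scaleNr => /(linJ_eq0 v0) [b0].
  move/eqP; rewrite oppr_eq0 => /eqP d0.
  rewrite (mx11_scalar b) (mx11_scalar d) b0 d0 raddf0.
  by rewrite !row_mx0.
have Bfull : row_full B.
  by move: Bfree; rewrite /row_free /row_full => /eqP ->; apply/eqP; lia.
apply: gform_nondeg => Z.
have /submxP [c ->] : (Z <= B)%MS by apply: submx_full.
rewrite -(hsubmxK c) -(hsubmxK (rsubmx c)) /B !mul_row_col !gformDr.
rewrite gformC normal_tangent // add0r.
rewrite (mx11_scalar (lsubmx (rsubmx c))) (mx11_scalar (rsubmx (rsubmx c))).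
by rewrite !mul_scalar_mx !gformZr ![g w _]gformC vw Jvw !mulr0 addr0.
Qed.

End Tangent.
End NordenAlgebra.

(** * Directional derivatives *)

Section Calculus.
Context {R : realType} {V : normedModType R}.
Implicit Types (x y v a b : V).

Lemma is_derive_mxP m n (f : V -> 'M[R]_(m, n)) x v (df : 'M[R]_(m, n)) :
  is_derive x v f df <-> forall i j, is_derive x v (fun w => f w i j) (df i j).
Proof.
split=> [[fd <-] i j|h].
  apply: DeriveDef; first by move/derivable_mxP: fd; apply.
  by rewrite derive_mx // mxE.
have fd : derivable f x v by apply/derivable_mxP => i j; case: (h i j).
apply: DeriveDef => //; rewrite derive_mx //; apply/matrixP => i j.
by rewrite mxE; case: (h i j).
Qed.

Lemma is_derive_fsum (I : finType) (h : I -> V -> R) x v (d : I -> R) :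
  (forall i, is_derive x v (h i) (d i)) ->
  is_derive x v (fun w => \sum_i h i w) (\sum_i d i).
Proof.
move=> hd; rewrite (_ : (fun w => _) = \sum_i h i); last first.
  by apply/funext => w; rewrite fct_sumE.
by elim/big_ind2: _ => [|? ? ? ? ? ?|//]; [exact: is_derive_cst|exact: is_deriveD].
Qed.

Lemma is_derive_mul (f h : V -> R) x v (df dh : R) :
  is_derive x v f df -> is_derive x v h dh ->
  is_derive x v (fun w => f w * h w) (df * h x + f x * dh).
Proof.
move=> fd hd; have := is_deriveM fd hd.
by rewrite (_ : f x *: dh + h x *: df = df * h x + f x * dh) // addrC [_ *: df]mulrC.
Qed.

Lemma is_derive_line (f : V -> R) x v (t : R) : derivable f (x + t *: v) v ->
  is_derive t 1 (fun s : R => f (x + s *: v)) ('D_v f (x + t *: v)).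
Proof.
have E : (fun h : R => h^-1 *: (f (x + (h *: 1 + t) *: v) - f (x + t *: v))) =
         (fun h : R => h^-1 *: (f (h *: v + (x + t *: v)) - f (x + t *: v))).
  apply/funext => h; congr (_ *: (f _ - _)).
  by rewrite [h *: 1]mulr1 scalerDl addrCA.
by move=> fd; apply: DeriveDef; rewrite /derivable /derive /= E.
Qed.

Lemma MVT_line (f : V -> R) x v (h : R) : 0 < h ->
  (forall t, 0 <= t <= h -> derivable f (x + t *: v) v) ->
  exists2 t, 0 <= t <= h & f (x + h *: v) - f x = 'D_v f (x + t *: v) * h.
Proof.
move=> h0 fd.
have [|t||c] := @MVT_segment R (fun s => f (x + s *: v))
    (fun s => 'D_v f (x + s *: v)) 0 h.
- exact: ltW.
- by rewrite in_itv /= => /andP[? ?]; apply/is_derive_line/fd; rewrite !ltW.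
- apply: derivable_within_continuous => t; rewrite in_itv /= => ht.
  by have [] := is_derive_line (fd _ ht).
by rewrite in_itv /= scale0r addr0 subr0 => ? ?; exists c.
Qed.

(** The second difference is the increment along [b] of [F], itself an increment along [a]. The mean
    value theorem is applied to [F] along [b], then to ['D_b f] along [a]. *)
Lemma second_difference (f : V -> R) x a b (h : R) : 0 < h ->
  (forall s t, 0 <= s <= h -> 0 <= t <= h -> derivable f (x + s *: a + t *: b) b /\
     derivable ('D_b f) (x + s *: a + t *: b) a) ->
  exists s t, [/\ 0 <= s <= h, 0 <= t <= h &
    f (x + h *: a + h *: b) - f (x + h *: a) - f (x + h *: b) + f x =
    'D_a ('D_b f) (x + s *: a + t *: b) * h * h].
Proof.
move=> h0 fd.
have hh : 0 <= h <= h by rewrite lexx ltW.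
have h00 : 0 <= (0 : R) <= h by rewrite lexx ltW.
pose F y := f (h *: a + y) - f y.
have Fd t : 0 <= t <= h -> is_derive (x + t *: b) b F
    ('D_b f (x + h *: a + t *: b) - 'D_b f (x + t *: b)).
  move=> ht.
  have [d1 _] := fd _ _ hh ht; have [d2 _] := fd _ _ h00 ht.
  rewrite scale0r addr0 in d2.
  have E : (fun k : R => k^-1 *: ((fun y => f (h *: a + y)) (k *: b + (x + t *: b))
      - (fun y => f (h *: a + y)) (x + t *: b))) =
    (fun k : R => k^-1 *: (f (k *: b + (x + h *: a + t *: b)) - f (x + h *: a + t *: b))).
    have E2 : h *: a + (x + t *: b) = x + h *: a + t *: b.
      by rewrite addrA (addrC _ x).
    by apply/funext => k; rewrite E2 addrCA E2.
  apply: is_deriveB; apply: DeriveDef => //.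
    by rewrite /derivable /= E.
  by rewrite /derive /= E.
have [t ht Et] := MVT_line h0 (fun t ht => @ex_derive _ _ _ _ _ _ _ (Fd t ht)).
have [|s hs Es] := @MVT_line ('D_b f) (x + t *: b) a h h0.
  by move=> s hs; rewrite addrAC; case: (fd _ _ hs ht).
exists s, t; split => //.
move: Et; rewrite (@derive_val _ _ _ _ _ _ _ (Fd t ht)).
rewrite (addrAC x (h *: a)) Es (addrAC x (t *: b)) /F => <-.
by rewrite !(addrC (h *: a)) (addrAC x (h *: b)); ring.
Qed.

Lemma dist_triangle_lt (p q r d e : R) :
  `|p - r| < d -> `|q - r| < e -> `|p - q| < d + e.
Proof.
by move=> pr qr; rewrite -(subrKA r) (le_lt_trans (ler_normD _ _)) // ltrD // distrC.
Qed.

(** Schwarz's theorem: on a small parallelogram both mixed derivatives take, at suitable points, the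
    value of the same second difference divided by [h * h]; continuity at [x] then identifies
    them. *)
Lemma derive_comm (f : V -> R) x a b :
  (\forall y \near x, [/\ derivable f y a, derivable f y b,
      derivable ('D_a f) y b & derivable ('D_b f) y a]) ->
  {for x, continuous ('D_a ('D_b f))} -> {for x, continuous ('D_b ('D_a f))} ->
  'D_a ('D_b f) x = 'D_b ('D_a f) x.
Proof.
move=> fd ca cb; apply/eqP; rewrite -subr_eq0; apply/negPn/negP => ne.
(* Half of the supposed gap, so that two errors below [e] contradict it. *)
set D := _ - _ in ne; pose e := `|D| / 2.
have e0 : 0 < e by rewrite divr_gt0 ?normr_gt0.
move/cvgrPdist_lt: ca => /(_ _ e0) ca; move/cvgrPdist_lt: cb => /(_ _ e0) cb.
have : nbhs x [set y | [/\ derivable f y a, derivable f y b,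
    derivable ('D_a f) y b & derivable ('D_b f) y a] /\
    (`|'D_a ('D_b f) x - 'D_a ('D_b f) y| < e /\
     `|'D_b ('D_a f) x - 'D_b ('D_a f) y| < e)] by exact: filterI fd (filterI ca cb).
case/nbhs_ballP => r /= r0 rP.
(* The parallelogram with sides [h a] and [h b] stays inside the ball; the summand 1 keeps the
   denominator positive and the norm estimate strict. *)
pose h := r / (`|a| + `|b| + 1).
have ab : 0 < `|a| + `|b| + 1 by rewrite ltr_wpDl // addr_ge0.
have h0 : 0 < h by rewrite divr_gt0.
have in_r s t : 0 <= s <= h -> 0 <= t <= h -> ball x r (x + s *: a + t *: b).
  move=> /andP[s0 sh] /andP[t0 th].
  rewrite -ball_normE /= -addrA opprD addrA subrr add0r normrN (le_lt_trans (ler_normD _ _)) //.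
  rewrite !normrZ !ger0_norm // (@le_lt_trans _ _ (h * `|a| + h * `|b|)) //.
    by rewrite lerD // ler_wpM2r.
  have -> : r = h * (`|a| + `|b| + 1) by rewrite /h divfK // gt_eqF.
  by rewrite -mulrDr ltr_pM2l // ltrDl.
have [|s [t [hs ht E1]]] := @second_difference f x a b h h0.
  by move=> s t hs ht; have [[_ d1 _ d2] _] := rP _ (in_r s t hs ht).
have [|s' [t' [hs' ht' E2]]] := @second_difference f x b a h h0.
  move=> s' t' hs' ht'; rewrite (addrAC x (s' *: b)).
  by have [[d1 _ d2 _] _] := rP _ (in_r t' s' ht' hs').
have [_ [+ _]] := rP _ (in_r s t hs ht); have [_ [_]] := rP _ (in_r t' s' ht' hs').
have E3 : f (x + h *: a + h *: b) - f (x + h *: a) - f (x + h *: b) + f x =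
          f (x + h *: b + h *: a) - f (x + h *: b) - f (x + h *: a) + f x.
  by rewrite (addrAC x (h *: b)); congr (_ + _); exact: addrAC.
rewrite E3 E2 (addrAC x (s' *: b)) in E1.
have <- : 'D_b ('D_a f) (x + t' *: a + s' *: b) = 'D_a ('D_b f) (x + s *: a + t *: b).
  have hn : h != 0 by rewrite gt_eqF.
  exact: (mulIf hn (mulIf hn E1)).
move=> q2 q1; have : `|D| < e + e by exact: dist_triangle_lt q1 q2.
by rewrite /e -splitr ltxx.
Qed.

Lemma differentiable_fsum (I : finType) (h : I -> V -> R) x :
  (forall i, differentiable (h i) x) -> differentiable (fun w => \sum_i h i w) x.
Proof.
move=> hd; rewrite (_ : (fun w => _) = \sum_i h i); last first.
  by apply/funext => w; rewrite fct_sumE.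
by elim/big_ind: _ => // *; exact: differentiableD.
Qed.

Lemma differentiable_fprod (I : finType) (h : I -> V -> R) x :
  (forall i, differentiable (h i) x) -> differentiable (fun w => \prod_i h i w) x.
Proof.
move=> hd; rewrite (_ : (fun w => _) = \prod_i h i); last first.
  by apply/funext => w; rewrite fct_prodE.
by elim/big_ind: _ => [|*|//]; [exact: differentiable_cst|exact: differentiableM].
Qed.

Definition mxdiff m n (f : V -> 'M[R]_(m, n)) x :=
  forall i j, differentiable (fun w => f w i j) x.

Lemma differentiable_mxdiff m n (f : V -> 'M[R]_(m, n)) x :
  differentiable f x -> mxdiff f x.
Proof.
move=> fd i j.
exact: (@differentiable_comp _ _ _ _ f (fun N : 'M[R]_(m, n) => N i j) x fd
  (differentiable_coord _ i j)).
Qed.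

Lemma mxdiff_derivable m n (f : V -> 'M[R]_(m, n)) x v :
  mxdiff f x -> derivable f x v.
Proof. by move=> fd; apply/derivable_mxP => i j; apply: diff_derivable. Qed.

Lemma mxdiff_mul m n p (f : V -> 'M[R]_(m, n)) (h : V -> 'M[R]_(n, p)) x :
  mxdiff f x -> mxdiff h x -> mxdiff (fun w => f w *m h w) x.
Proof.
move=> fd hd i j; under eq_fun do rewrite mxE.
by apply: differentiable_fsum => k; exact: differentiableM.
Qed.

Lemma mxdiff_cst m n (A : 'M[R]_(m, n)) x : mxdiff (fun=> A) x.
Proof. by move=> i j; exact: differentiable_cst. Qed.

Lemma mxdiff_tr m n (f : V -> 'M[R]_(m, n)) x :
  mxdiff f x -> mxdiff (fun w => (f w)^T) x.
Proof. by move=> fd i j; under eq_fun do rewrite mxE. Qed.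

Lemma mxdiffD m n (f h : V -> 'M[R]_(m, n)) x :
  mxdiff f x -> mxdiff h x -> mxdiff (fun w => f w + h w) x.
Proof.
by move=> fd hd i j; under eq_fun do rewrite !mxE; exact: differentiableD.
Qed.

Lemma mxdiffB m n (f h : V -> 'M[R]_(m, n)) x :
  mxdiff f x -> mxdiff h x -> mxdiff (fun w => f w - h w) x.
Proof.
by move=> fd hd i j; under eq_fun do rewrite !mxE; exact: differentiableB.
Qed.

Lemma differentiable_det m (f : V -> 'M[R]_m) x :
  mxdiff f x -> differentiable (fun w => \det (f w)) x.
Proof.
move=> fd; apply: differentiable_fsum => s; apply: differentiableM.
  exact: differentiable_cst.
exact: differentiable_fprod.
Qed.

(** The first-order expansion at [x] depends only on the germ there. This serves where a formula,
    for an inverse matrix or an iterated derivative, is known only near the point. *)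
Lemma near_eq_differentiable (W : normedModType R) (f h : V -> W) x :
  (\near x, f x = h x) -> differentiable f x -> differentiable h x.
Proof.
move=> fh fd.
have E : h \o shift x = cst (h x) + 'd f x +o_ 0 id.
  have /eqaddoP fo := diff_locally fd.
  have fh0 : \forall y \near (0 : V), f (y + x) = h (y + x).
    have := fh; rewrite (near_shift 0 x); apply: filterS => y /=.
    by rewrite subr0.
  apply/eqaddoP => e e0; apply: filterS2 fh0 (fo e e0) => y E.
  by rewrite !fctE /= E (nbhs_singleton fh).
have D : 'd h x = 'd f x :> (V -> W).
  by apply: diff_unique => //; exact: diff_continuous.
by apply/diff_locallyP; rewrite D; split => //; exact: diff_continuous.
Qed.

Lemma mxdiff_inv m (f : V -> 'M[R]_m) x : mxdiff f x ->
  \det (f x) != 0 -> mxdiff (fun w => invmx (f w)) x.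
Proof.
move=> fd fx i j.
(* [invmx] returns its argument when the matrix is singular, so Cramer's formula is used only where
   the determinant is nonzero, a neighbourhood of [x] by continuity. *)
apply: (@near_eq_differentiable _ (fun w => (\det (f w))^-1 * (\adj (f w)) i j)).
  have := differentiable_continuous (differentiable_det fd).
  move/(_ _ (open_nbhs_nbhs (conj (@open_neq R 0) fx))).
  move=> det0; have : \forall y \near x, \det (f y) != 0 by [].
  by apply: filterS => y /= y0; rewrite /invmx unitmxE unitfE y0 [RHS]mxE.
apply: differentiableM; first by apply: differentiableV => //; exact: differentiable_det.
under eq_fun do rewrite mxE /cofactor.
apply: differentiableM; first exact: differentiable_cst.
apply: differentiable_det => k l; under eq_fun do rewrite !mxE.
exact: fd.
Qed.
End Calculus.

(** * Maps with vanishing partial derivatives *)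

Section PartialDerivatives.
Context {R : realType} {m : nat}.

Lemma derive_partials (f : 'rV[R]_m -> R) x v : differentiable f x ->
  'D_v f x = \sum_k v 0 k * 'D_(delta_mx 0 k) f x.
Proof.
move=> fd; rewrite deriveE // {1}(row_sum_delta v) linear_sum; apply: eq_bigr => k _.
by rewrite linearZ /= deriveE.
Qed.

(** The ball is convex, so the mean value theorem applies on the segment from [x] to [y], where the
    directional derivative is a combination of the partial ones. *)
Lemma partials0_constant (f : 'rV[R]_m -> R) x (r : R) :
  (forall y, ball x r y -> differentiable f y /\
     forall k, 'D_(delta_mx 0 k) f y = 0) ->
  forall y, ball x r y -> f y = f x.
Proof.
move=> fd y xy.
have in_r (t : R) : 0 <= t <= 1 -> ball x r (x + t *: (y - x)).
  move=> /andP[t0 t1]; move: xy; rewrite -ball_normE /= opprD addrA subrr add0r normrN.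
  rewrite distrC normrZ ger0_norm //; apply: le_lt_trans.
  by rewrite ler_piMl.
have [|t ht] := @MVT_line _ _ f x (y - x) 1 ltr01.
  by move=> t /in_r /fd[? _]; exact: diff_derivable.
have [fd1 p0] := fd _ (in_r _ ht).
rewrite derive_partials // big1 ?mul0r => [|k _]; last by rewrite p0 mulr0.
by rewrite scale1r subrKC => /eqP; rewrite subr_eq0 => /eqP.
Qed.

Lemma partials0_constant_mx p q (f : 'rV[R]_m -> 'M[R]_(p, q)) x (r : R) :
  (forall y, ball x r y -> mxdiff f y /\
     forall k, is_derive y (delta_mx 0 k) f 0) ->
  forall y, ball x r y -> f y = f x.
Proof.
move=> fd y xy; apply/matrixP => i j.
apply: (@partials0_constant (fun w => f w i j) x r) => // z xz.
have [df dk] := fd z xz; split; first exact: df.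
move=> k; have [_ ->] := (is_derive_mxP _ _ _ _).1 (dk k) i j.
by rewrite mxE.
Qed.

End PartialDerivatives.

(** * Differentiation of [J] and of the metric *)

Section FormCalculus.
Context {R : realType} {n : nat} {V : normedModType R}.
Local Notation amb := 'rV[R]_(n.+1 + n.+1).
Implicit Types (x v : V) (f h : V -> amb).

Lemma is_derive_mulmx p f (A : 'M[R]_(n.+1 + n.+1, p)) x v (df : amb) :
  is_derive x v f df -> is_derive x v (fun w => f w *m A) (df *m A).
Proof.
move=> /is_derive_mxP fd; apply/is_derive_mxP => i j.
rewrite mxE; under eq_fun do rewrite mxE.
apply: is_derive_fsum => k.
have := is_derive_mul (fd i k) (is_derive_cst (A k j) x v).
by rewrite mulr0 addr0.
Qed.

Lemma is_derive_Jv f x v (df : amb) :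
  is_derive x v f df -> is_derive x v (fun w => Jv (f w)) (Jv df).
Proof. exact: is_derive_mulmx. Qed.

Lemma is_derive_gform f h x v (df dh : amb) :
  is_derive x v f df -> is_derive x v h dh ->
  is_derive x v (fun w => gform (f w) (h w)) (gform df (h x) + gform (f x) dh).
Proof.
move=> fd hd.
have /is_derive_mxP fE := is_derive_mulmx (@gmx R n) fd.
move/is_derive_mxP: hd => hd.
have E Z W : gform Z W = \sum_k (Z *m @gmx R n) 0 k * W 0 k.
  by rewrite gformE mxE; apply: eq_bigr => k _; rewrite [W^T _ _]mxE.
rewrite !E -big_split /=; under eq_fun do rewrite E.
by apply: is_derive_fsum => k; exact: is_derive_mul.
Qed.

Lemma is_derive_mxdiff f x v : mxdiff f x -> is_derive x v f ('D_v f x).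
Proof. by move=> fd; apply/derivableP/mxdiff_derivable. Qed.

Lemma mxdiff_Jv f x : mxdiff f x -> mxdiff (fun w => Jv (f w)) x.
Proof. by move=> fd; apply: mxdiff_mul (mxdiff_cst _ _). Qed.

Lemma differentiable_gform f h x : mxdiff f x -> mxdiff h x ->
  differentiable (fun w => gform (f w) (h w)) x.
Proof.
move=> fd hd; under eq_fun do rewrite gformE.
apply: (mxdiff_mul _ (mxdiff_tr hd)); exact: mxdiff_mul fd (mxdiff_cst _ _).
Qed.

(** The device for differentiating an identity valid on [U]: the derivatives of its two sides,
    computed by different rules, must agree. *)
Lemma is_derive_open_unique (W : normedModType R) (U : set V) (f h : V -> W) x v
    (a b : W) : open U -> U x -> (forall y, U y -> f y = h y) ->
  is_derive x v f a -> is_derive x v h b -> a = b.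
Proof.
move=> oU Ux fh fd hd.
have fhn : \near x, f x = h x.
  by have : nbhs x U by [exact: open_nbhs_nbhs]; apply: filterS.
have fd' := near_eq_is_derive fhn fd.
by rewrite -(@derive_val _ _ _ _ _ _ _ fd') (@derive_val _ _ _ _ _ _ _ hd).
Qed.

End FormCalculus.

(** * Smooth charts, their normal projection and mean curvature *)

Section Chart.
Variables (R : realType) (n : nat).
Local Notation amb := 'rV[R]_(n.+1 + n.+1).
Local Notation par := 'rV[R]_(n + n).
Local Notation J := (@Jv R n).
Local Notation g := (@gform R n).
Local Notation e := (@ee R n).
Variables (U : set par) (phi : par -> amb).
Hypothesis oU : open U.
Hypothesis smU : smooth_on U phi.
Local Notation T := (Tmx phi).
Local Notation t := (fun k w => derive phi w (e k)).

Lemma near_chart u : U u -> \forall w \near u, U w.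
Proof. by move=> Uu; exact: open_nbhs_nbhs. Qed.

Lemma row_Tmx k u : row k (T u) = t k u.
Proof. by apply/rowP => i; rewrite !mxE. Qed.

Lemma mxdiff_Diter s u : U u -> mxdiff (Diter s phi) u.
Proof. by move=> Uu; exact/differentiable_mxdiff/smU. Qed.

Lemma mxdiff_d1 k u : U u -> mxdiff (t k) u.
Proof. exact: (mxdiff_Diter [:: e k]). Qed.

Lemma mxdiff_d2 i j u : U u -> mxdiff (d2 phi i j) u.
Proof. exact: (mxdiff_Diter [:: e i; e j]). Qed.

Lemma derive_Diter_entry s a k u : U u ->
  'D_a (fun w => Diter s phi w 0 k) u = Diter (a :: s) phi u 0 k.
Proof.
move=> Uu; rewrite /= derive_mx ?mxE //.
exact/mxdiff_derivable/mxdiff_Diter.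
Qed.

(** Schwarz's theorem for each coordinate of [Diter s phi]. An empty [s] gives the symmetry of
    second derivatives, a single direction that of third derivatives. *)
Lemma Diter_comm s a b u : U u ->
  Diter [:: a, b & s] phi u = Diter [:: b, a & s] phi u.
Proof.
move=> Uu; apply/rowP => k; pose F w : R := Diter s phi w 0 k.
(* Coordinates of iterated derivatives are matched with iterated derivatives of the coordinate [F];
   this holds on [U] only, hence the statements near a point. *)
have D1 c w : U w -> \near w, Diter (c :: s) phi w 0 k = 'D_c F w.
  by move=> Uw; near=> z; rewrite derive_Diter_entry //; near: z; exact: near_chart.
have D2 c d w : U w -> 'D_d ('D_c F) w = Diter [:: d, c & s] phi w 0 k.
  by move=> Uw; rewrite -(near_eq_derive _ (D1 c w Uw)) derive_Diter_entry.
have cont c d : {for u, continuous ('D_d ('D_c F))}.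
  apply: differentiable_continuous.
  apply: (@near_eq_differentiable _ _ _ (fun w => Diter [:: d, c & s] phi w 0 k)).
    by near=> z; rewrite D2 //; near: z; exact: near_chart.
  exact: mxdiff_Diter.
apply: etrans (esym (D2 b a u Uu)) (etrans _ (D2 a b u Uu)).
apply: (@derive_comm _ _ F u a b); [|exact: cont|exact: cont].
near=> w; have Uw : U w by near: w; exact: near_chart.
by split; do ?[exact/diff_derivable/mxdiff_Diter];
  apply: near_eq_derivable (D1 _ w Uw) _; exact/diff_derivable/mxdiff_Diter.
Unshelve. all: by end_near. Qed.

Lemma d2C i j u : U u -> d2 phi i j u = d2 phi j i u.
Proof. exact: (Diter_comm [::]). Qed.

Lemma mxdiff_Tmx u : U u -> mxdiff T u.
Proof. by move=> Uu i j; under eq_fun do rewrite mxE; exact: mxdiff_d1. Qed.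

Lemma norE u v : nor phi u v = normal_part (T u) v.
Proof.
rewrite /nor /normal_part gform_rows [in RHS]mulmx_sum_row; congr (_ - _).
by apply: eq_bigr => i _; congr (_ *: _); rewrite mxE; apply: eq_bigr => j _; rewrite mxE.
Qed.

Hypothesis UTg : forall u, U u -> \det (gram (T u)) != 0.

Lemma mxdiff_gram u : U u -> mxdiff (fun w => gram (T w)) u.
Proof.
move=> Uu; under eq_fun do rewrite gram_mulmx.
apply: (mxdiff_mul _ (mxdiff_tr (mxdiff_Tmx Uu))).
exact: mxdiff_mul (mxdiff_Tmx Uu) (mxdiff_cst _ _).
Qed.

Lemma mxdiff_invgram u : U u -> mxdiff (fun w => invmx (gram (T w))) u.
Proof. by move=> Uu; apply: mxdiff_inv (mxdiff_gram Uu) (UTg Uu). Qed.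

Lemma mxdiff_nor f u : U u -> mxdiff f u -> mxdiff (fun w => nor phi w (f w)) u.
Proof.
move=> Uu fd; under eq_fun do rewrite norE.
apply: (mxdiffB fd); apply: (mxdiff_mul _ (mxdiff_Tmx Uu)).
apply: (mxdiff_mul _ (mxdiff_invgram Uu)).
apply: (mxdiff_mul _ (mxdiff_tr (mxdiff_Tmx Uu))).
exact: mxdiff_mul fd (mxdiff_cst _ _).
Qed.

Lemma nor_normal u v : U u -> is_normal (T u) (nor phi u v).
Proof. by move=> Uu; rewrite norE; apply: normal_part_normal; exact: UTg. Qed.

Local Notation H := (Hmean phi).

Lemma mxdiff_Hmean u : U u -> mxdiff H u.
Proof.
move=> Uu k l.
have E : (fun w => H w k l) = (fun w => (n + n)%:R^-1 *
    \sum_i \sum_j invmx (gram (T w)) i j * nor phi w (d2 phi i j w) k l).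
  apply/funext => w; rewrite mxE summxE; congr (_ * _).
  by apply: eq_bigr => i _; rewrite summxE; apply: eq_bigr => j _; rewrite mxE.
rewrite E; apply: differentiableM; first exact: differentiable_cst.
apply: differentiable_fsum => i; apply: differentiable_fsum => j.
apply: differentiableM; first exact: mxdiff_invgram.
exact: mxdiff_nor Uu (mxdiff_d2 i j Uu) k l.
Qed.

Lemma Hmean_normal u : U u -> is_normal (T u) (H u).
Proof.
move=> Uu; apply: is_normalZ; elim/big_ind: _ => [i|v w|i _].
- exact: gform0r.
- exact: is_normalD.
elim/big_ind: _ => [k|v w|j _]; [exact: gform0r|exact: is_normalD|].
exact/is_normalZ/nor_normal.
Qed.

End Chart.

(** * Codazzi equation of an umbilical frame *)

Section MovingFrame.
Variables (R : realType) (n : nat) (V : normedModType R).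
Local Notation amb := 'rV[R]_(n.+1 + n.+1).
Local Notation I := 'I_(n + n).
Local Notation J := (@Jv R n).
Local Notation g := (@gform R n).
(** The rows of [T] stand for the first derivatives of a chart, [s] and [r] for the second and third
    ones, and [dH] for the derivatives of the mean curvature. *)
Variables (U : set V) (e : I -> V) (T : V -> 'M[R]_(n + n, n.+1 + n.+1)).
Variables (s : I -> I -> V -> amb) (r : I -> I -> I -> V -> amb).
Variables (H : V -> amb) (dH : I -> V -> amb).
Local Notation t := (fun k w => row k (T w)).
Hypothesis oU : open U.
Hypothesis tD : forall u i k, U u -> is_derive u (e k) (t i) (s k i u).
Hypothesis sD : forall u i j k, U u -> is_derive u (e k) (s i j) (r k i j u).
Hypothesis HD : forall u k, U u -> is_derive u (e k) H (dH k u).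
Hypothesis sC : forall u i j, U u -> s i j u = s j i u.
Hypothesis rC : forall u i j k, U u -> r k i j u = r i k j u.
Hypothesis Tf : forall u, U u -> row_free (T u).
Hypothesis Tg : forall u, U u -> \det (gram (T u)) != 0.
Hypothesis TJ : forall u, U u -> (T u *m Jmx R n == T u)%MS.
Hypothesis Hn : forall u, U u -> is_normal (T u) (H u).
Hypothesis umb : forall u i j, U u ->
  normal_part (T u) (s i j u) = g (t i u) (t j u) *: H u - g (J (t i u)) (t j u) *: J (H u).
Local Notation c1 := (fun w => g (H w) (H w)).
Local Notation c2 := (fun w => g (J (H w)) (H w)).

Lemma gform_s_normal u i j v : U u -> is_normal (T u) v ->
  g (s i j u) v =
  g (t i u) (t j u) * g (H u) v - g (J (t i u)) (t j u) * g (J (H u)) v.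
Proof.
by move=> Uu nv; rewrite -(gform_normal_part _ nv) umb // !gformL.
Qed.

Lemma derive_gform_H u k : U u -> is_derive u (e k) c1 (2 * g (H u) (dH k u)).
Proof.
move=> Uu; apply: (is_derive_eq (is_derive_gform (HD k Uu) (HD k Uu))).
by rewrite gformC mulr2n mulrDl mul1r.
Qed.

Lemma derive_gformJ_H u k : U u -> is_derive u (e k) c2 (2 * g (J (H u)) (dH k u)).
Proof.
move=> Uu; apply: (is_derive_eq (is_derive_gform (is_derive_Jv (HD k Uu)) (HD k Uu))).
by rewrite gform_J gformC mulr2n mulrDl mul1r.
Qed.

(** Differentiating [g (t l, H) = 0] and inserting umbilicity shows that the tangential part of
    [d_k H] is [- c d_k phi], where [c = c1 + i c2] and [i] acts as [- J]. *)
Lemma derive_H_normal u k : U u ->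
  is_normal (T u) (dH k u + c1 u *: t k u - c2 u *: J (t k u)).
Proof.
move=> Uu l.
have : g (s k l u) (H u) + g (t l u) (dH k u) = 0.
  apply: (is_derive_open_unique oU Uu _ (is_derive_gform (tD l k Uu) (HD k Uu))
    (is_derive_cst 0 _ _)).
  by move=> w Uw; exact: Hn.
rewrite (gform_s_normal _ _ Uu (Hn Uu)) /= !gformL.
rewrite (gformC (row l (T u)) (row k (T u))) (gformC (row l (T u)) (J _)) => E.
by rewrite -[RHS]E; ring.
Qed.

(** This isolates the real part of [G_ij d_k c]. The identity [g (s i j, H) = Re (G_ij c)] is
    differentiated along [e k], and the term with [dH] is computed by pairing [s i j] with the
    normal vector of [derive_H_normal]. The right-hand side is symmetric in [i] and [k] once [s] and
    [r] are. *)
Lemma codazzi_half u i j k : U u ->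
  g (t i u) (t j u) * (2 * g (H u) (dH k u)) - g (J (t i u)) (t j u) * (2 * g (J (H u)) (dH k u)) =
  2 * (g (r k i j u) (H u)
  - (g (s k i u) (t j u) + g (s k j u) (t i u) + g (s i j u) (t k u)) * c1 u
  + (g (J (s k i u)) (t j u) + g (J (s k j u)) (t i u) + g (J (s i j u)) (t k u)) * c2 u).
Proof.
move=> Uu.
have E1 := is_derive_open_unique oU Uu
  (fun w Uw => gform_s_normal i j Uw (Hn Uw)) (is_derive_gform (sD i j k Uu) (HD k Uu))
  (is_deriveB (is_derive_mul (is_derive_gform (tD i k Uu) (tD j k Uu)) (derive_gform_H k Uu))
     (is_derive_mul (is_derive_gform (is_derive_Jv (tD i k Uu)) (tD j k Uu))
        (derive_gformJ_H k Uu))).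
have E2 := gform_s_normal i j Uu (derive_H_normal k Uu).
have nH := Hn Uu; have nJH := is_normalJ (TJ Uu) nH.
have z1 : g (H u) (t k u) = 0 by rewrite gformC nH.
have z2 : g (J (H u)) (t k u) = 0 by rewrite gformC nJH.
have z3 : g (H u) (J (t k u)) = 0 by rewrite -gform_J.
have z4 : g (J (H u)) (J (t k u)) = 0 by rewrite gform_JJ z1 oppr0.
rewrite /= in E1 E2 z1 z2 z3 z4 *.
rewrite !gformL z1 z2 z3 z4 !mulr0 !addr0 !subr0 -gform_J in E2.
rewrite (gform_J (row i (T u)) (s k j u)) in E1.
rewrite (gformC (row i (T u)) (s k j u)) (gformC (row i (T u)) (J (s k j u))) in E1.
move: E1 E2.
set q := g (s i j u) (dH k u); set a := g (row i (T u)) (row j (T u)).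
set b := g (J (row i (T u))) _; set x := g (H u) (dH k u); set y := g (J (H u)) (dH k u).
set k1 := g (H u) (H u); set k2 := g (J (H u)) (H u).
set A1 := g (s k i u) _; set A2 := g (s k j u) _; set A3 := g (s i j u) _.
set B1 := g (J (s k i u)) _; set B2 := g (J (s k j u)) _; set B3 := g (J (s i j u)) _.
set D := g (r _ _ _ _) _.
move=> E1 E2.
have -> : D = (A1 + A2) * k1 + a * (2 * x) - ((B1 + B2) * k2 + b * (2 * y)) - q.
  by rewrite -E1; ring.
have -> : q = a * x - b * y - k1 * A3 + k2 * B3 by rewrite -E2; ring.
by ring.
Qed.

Lemma codazzi u i j k : U u ->
  g (t i u) (t j u) * (2 * g (H u) (dH k u)) - g (J (t i u)) (t j u) * (2 * g (J (H u)) (dH k u)) =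
  g (t k u) (t j u) * (2 * g (H u) (dH i u)) - g (J (t k u)) (t j u) * (2 * g (J (H u)) (dH i u)).
Proof.
move=> Uu; rewrite !codazzi_half // (rC i j k Uu) (sC k i Uu).
by ring.
Qed.

(** Both quantities are half the derivatives of [c1] and [c2]. Contracting [codazzi] over [j] with a
    tangent [y] that is [G]-orthogonal to [t k] leaves [Re (G (t i, y) d_k c) = 0] for every [i],
    which forces [d_k c = 0]. *)
Lemma gform_H_dH u k : (1 < n)%N -> U u ->
  g (H u) (dH k u) = 0 /\ g (J (H u)) (dH k u) = 0.
Proof.
move=> n1 Uu.
have [c [c0 E1 E2]] := tangent_orthogonal (t k u) n1 (Tf Uu).
suff [] : 2 * g (H u) (dH k u) = 0 /\ 2 * g (J (H u)) (dH k u) = 0.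
  by move=> /eqP; rewrite mulf_eq0 pnatr_eq0 /= => /eqP -> /eqP;
    rewrite mulf_eq0 pnatr_eq0 /= => /eqP ->.
apply: (tangent_linJ_eq0 (TJ Uu) (Tg Uu) c0) => i; rewrite /gtilde !gform_row_mul.
rewrite !mulr_sumr -sumrB /=.
transitivity (\sum_j c 0 j * (g (t k u) (t j u) * (2 * g (H u) (dH i u)) -
  g (J (t k u)) (t j u) * (2 * g (J (H u)) (dH i u)))).
  by apply: eq_bigr => j _; rewrite -codazzi //=; ring.
transitivity (g (t k u) (c *m T u) * (2 * g (H u) (dH i u)) -
  gtilde (t k u) (c *m T u) * (2 * g (J (H u)) (dH i u))); last first.
  by rewrite E1 E2 !mul0r subr0.
rewrite /gtilde !gform_row_mul !mulr_suml -sumrB /=.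
by apply: eq_bigr => j _; ring.
Qed.

Lemma gform_curvature_derive0 u k : (1 < n)%N -> U u ->
  is_derive u (e k) c1 0 /\ is_derive u (e k) c2 0.
Proof.
move=> n1 Uu; have [E1 E2] := gform_H_dH k n1 Uu.
split; [apply: is_derive_eq (derive_gform_H k Uu) _ | apply: is_derive_eq (derive_gformJ_H k Uu) _].
  by rewrite E1 mulr0.
by rewrite E2 mulr0.
Qed.

(** The normal vector of [derive_H_normal] is orthogonal to [H] and [J H] because [c] has zero
    derivative, and a nonzero [H] spans the complex normal line. *)
Lemma dH_tangent u k : (1 < n)%N -> U u -> H u != 0 ->
  dH k u = c2 u *: J (t k u) - c1 u *: t k u.
Proof.
move=> n1 Uu H0; have [E1 E2] := gform_H_dH k n1 Uu.
have nH := Hn Uu; have nJH := is_normalJ (TJ Uu) nH.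
have z1 : g (H u) (t k u) = 0 by rewrite gformC nH.
have z2 : g (J (H u)) (t k u) = 0 by rewrite gformC nJH.
have : dH k u + c1 u *: t k u - c2 u *: J (t k u) = 0.
  apply: (normal_line (TJ Uu) (Tg Uu) nH (derive_H_normal k Uu) H0).
    by rewrite !gformL -gform_J z1 z2 E1 !(mulr0, addr0, subr0).
  by rewrite !gformL gform_JJ z1 z2 E2 !(mulr0, oppr0, addr0, subr0).
by move=> E; apply/eqP; rewrite -subr_eq0 opprB addrA E.
Qed.

Lemma normal_isotropic0 u v : U u -> is_normal (T u) v ->
  g v v = 0 -> g (J v) v = 0 -> v = 0.
Proof.
move=> Uu nv E1 E2; apply/eqP/negPn/negP => v0.
by move: (v0); rewrite (normal_line (TJ Uu) (Tg Uu) nv nv v0 E1 E2) eqxx.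
Qed.

(** * Spheres and planes containing an umbilical piece *)

Section Position.
Variable f : V -> amb.
Hypothesis fD : forall u k, U u -> is_derive u (e k) f (t k u).
Hypothesis n0 : (0 < n)%N.

Lemma frame_nondeg u : U u -> ~ (forall i k, g (t i u) (t k u) = 0).
Proof.
move=> Uu E; have i0 : I by apply: (@Ordinal _ 0); rewrite addn_gt0 n0.
have : delta_mx 0 i0 = 0 :> 'rV[R]_(n + n).
  by apply: (tangent_nondeg (Tg Uu)) => i; rewrite -rowE E.
by move=> /rowP/(_ i0); rewrite !mxE !eqxx => /eqP; rewrite oner_eq0.
Qed.

Lemma sphere_normal Z0 a u : (forall w, U w -> g (f w - Z0) (f w - Z0) = a) ->
  U u -> is_normal (T u) (f u - Z0).
Proof.
move=> fa Uu k.
have fZ := is_deriveB (fD k Uu) (is_derive_cst Z0 u (e k)).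
have := is_derive_open_unique oU Uu fa (is_derive_gform fZ fZ) (is_derive_cst a u (e k)).
rewrite subr0 [g (_ - _) _]gformC -mulr2n => /eqP.
by rewrite mulrn_eq0 /= => /eqP.
Qed.

Lemma sphere_d2 Z0 a u i k : (forall w, U w -> g (f w - Z0) (f w - Z0) = a) ->
  U u -> g (s k i u) (f u - Z0) = - g (t i u) (t k u).
Proof.
move=> fa Uu.
have fZ := is_deriveB (fD k Uu) (is_derive_cst Z0 u (e k)).
have := is_derive_open_unique oU Uu (fun w Uw => sphere_normal fa Uw i)
  (is_derive_gform (tD i k Uu) fZ) (is_derive_cst 0 u (e k)).
by rewrite subr0 => /eqP; rewrite addr_eq0 => /eqP.
Qed.

(** If [H] vanished, the second derivatives would be tangent, and pairing them with the normal
    radius vector would give [g = 0] on the tangent space. *)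
Lemma sphere_H_neq0 Z0 a u : (forall w, U w -> g (f w - Z0) (f w - Z0) = a) ->
  U u -> H u != 0.
Proof.
move=> fa Uu; apply/negP => /eqP H0; apply: (frame_nondeg Uu) => i k.
apply: oppr_inj; rewrite -(sphere_d2 i k fa Uu).
rewrite (gform_s_normal _ _ Uu (sphere_normal fa Uu)) H0 /Jv mul0mx !gform0l.
by rewrite !mulr0 subrr oppr0.
Qed.

(** The difference [w] of the centres is normal, and the two second-order identities subtract to
    [Re (G_ik G (H, w)) = 0]. Hence [G (H, w) = 0], and [w = 0] since [H] spans the normal line. *)
Lemma sphere_center_unique Z Z' a a' u :
  (forall w, U w -> g (f w - Z) (f w - Z) = a) ->
  (forall w, U w -> g (f w - Z') (f w - Z') = a') -> U u -> Z = Z'.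
Proof.
move=> fa fa' Uu; pose w := (f u - Z) - (f u - Z').
have nw : is_normal (T u) w.
  exact: is_normalD (sphere_normal fa Uu) (is_normalN (sphere_normal fa' Uu)).
have i0 : I by apply: (@Ordinal _ 0); rewrite addn_gt0 n0.
have [||E1 E2] := @tangent_linJ_eq0 _ _ _ (TJ Uu) (Tg Uu) (delta_mx 0 i0)
    (g (H u) w) (g (J (H u)) w).
- apply/negP => /eqP E; have : delta_mx 0 i0 = 0 :> 'rV[R]_(n + n).
    by apply: (row_free_inj (Tf Uu)); rewrite E mul0mx.
  by move=> /rowP/(_ i0); rewrite !mxE !eqxx => /eqP; rewrite oner_eq0.
- move=> k; rewrite -rowE /gtilde mulrC (mulrC (g (J (H u)) w)).
  rewrite -(gform_s_normal k i0 Uu nw) /w gformDr gformNr.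
  by rewrite (sphere_d2 _ _ fa Uu) (sphere_d2 _ _ fa' Uu) subrr.
have : w = 0 := normal_line (TJ Uu) (Tg Uu) (Hn Uu) nw (sphere_H_neq0 fa Uu) E1 E2.
by rewrite /w opprB addrC addrA subrK => /eqP; rewrite subr_eq0 => /eqP.
Qed.

Section Plane.
Variables (Z0 : amb) (Wm : 'M[R]_(n + n, n.+1 + n.+1)).
Hypothesis Wf : row_free Wm.
Hypothesis fW : forall w, U w -> (f w - Z0 <= Wm)%MS.

(** Membership in the row space of [Wm] is the linear equation of being killed by [cokermx Wm],
    which can be differentiated; equality follows by rank. *)
Lemma plane_tangent u : U u -> (T u :=: Wm)%MS.
Proof.
move=> Uu; apply/eqmxP; rewrite -mxrank_leqif_eq.
  by move: Wf (Tf Uu); rewrite /row_free => /eqP -> /eqP ->.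
apply/row_subP => k.
have fZ := is_deriveB (fD k Uu) (is_derive_cst Z0 u (e k)).
rewrite submxE; apply/eqP; rewrite -[row k _]subr0.
apply: (is_derive_open_unique oU Uu _ (is_derive_mulmx (cokermx Wm) fZ) (is_derive_cst 0 _ _)).
by move=> w Uw; apply/eqP; rewrite -submxE; exact: fW.
Qed.

Lemma plane_d2 u i k : U u -> (s k i u <= T u)%MS.
Proof.
move=> Uu; rewrite plane_tangent // submxE; apply/eqP.
apply: (is_derive_open_unique oU Uu _ (is_derive_mulmx (cokermx Wm) (tD i k Uu))
  (is_derive_cst 0 _ _)).
by move=> w Uw; apply/eqP; rewrite -submxE -(plane_tangent Uw) row_sub.
Qed.

(** The second derivatives are tangent, so umbilicity reads [G_ik H = 0]; a nonzero [H] would make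
    the induced metric vanish. *)
Lemma plane_H_eq0 u : U u -> H u = 0.
Proof.
move=> Uu; apply/eqP/negPn/negP => H0; apply: (frame_nondeg Uu) => i k.
have /submxP [c E] := plane_d2 k i Uu.
have := umb i k Uu; rewrite E normal_part_tangent ?Tg // => /esym E2.
by have [] := linJ_eq0 H0 E2.
Qed.

End Plane.
End Position.

Variables (P : amb -> V -> amb) (dP : amb -> I -> V -> amb).
Hypothesis PE : forall u v, U u -> P v u = normal_part (T u) v.
Hypothesis PD : forall u v k, U u -> is_derive u (e k) (P v) (dP v k u).

(* With [H = 0] the derivative of the normal projection [P] maps into the normal
   bundle, and it is orthogonal to it because [g (P v) (P w) = g v (P w)]. *)
Lemma normal_part_derive0 u v k : (forall w, U w -> H w = 0) -> U u -> dP v k u = 0.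
Proof.
move=> H0 Uu.
have nP w z : U w -> is_normal (T w) (P z w).
  by move=> Uw; rewrite PE //; exact: normal_part_normal (Tg Uw) _.
have ndP z : is_normal (T u) (dP z k u).
  move=> l; have : g (s k l u) (P z u) + g (t l u) (dP z k u) = 0.
    apply: (is_derive_open_unique oU Uu _ (is_derive_gform (tD l k Uu) (PD z k Uu))
      (is_derive_cst 0 _ _)).
    by move=> w Uw; exact: nP.
  by rewrite (gform_s_normal _ _ Uu (nP _ z Uu)) H0 // /Jv mul0mx !gform0l !mulr0 subrr add0r.
apply: (normal_normal0 (Tg Uu) (ndP v)) => w nw.
have := is_derive_open_unique oU Uu _ (is_derive_gform (PD v k Uu) (PD w k Uu))
    (is_derive_gform (is_derive_cst v u (e k)) (PD w k Uu)).
have E z y : U z -> g (P v z) (P y z) = g v (P y z).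
  by move=> Uz; rewrite (PE v Uz); exact: gform_normal_part (nP _ _ Uz).
move/(_ (fun z Uz => E z w Uz)); rewrite gform0l add0r /= => EE.
have E3 := gform_normal_part v (ndP w); rewrite -PE // in E3.
have E4 := gform_normal_part w (ndP v); rewrite -PE // in E4.
rewrite -E4 gformC; apply: (addIr (g (P v u) (dP w k u))).
by rewrite EE E3 add0r.
Qed.

End MovingFrame.

(** * H-spheres and hyperplanes as umbilical hypersurfaces *)

(** With [c = k1 + i k2] one has [K = c f + h], and the centre is [K / c = f + h / c]. The radius
    data are [G (h / c, h / c) = 1 / c], whose parts are [k1 / m] and [- k2 / m]. *)
Lemma h_sphere_rescaled (R : realType) (n : nat) (f h : 'rV[R]_(n.+1 + n.+1)) (k1 k2 : R) :
  let m := k1 ^+ 2 + k2 ^+ 2 in let K := k1 *: f - k2 *: Jv f + h in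
  m != 0 -> gform h h = k1 -> gform (Jv h) h = k2 ->
  h_sphere ((k1 / m) *: K + (k2 / m) *: Jv K) (k1 / m) (- (k2 / m)) f.
Proof.
move=> m K m0 h1 h2.
have -> : (k1 / m) *: K + (k2 / m) *: Jv K = f + ((k1 / m) *: h + (k2 / m) *: Jv h).
  rewrite /K !JvL; move: (Jv f) (Jv h) => Jf Jh; apply/rowP => i.
  by rewrite !mxE /m; field.
rewrite /h_sphere /gtilde /= opprD addrA subrr add0r.
rewrite JvN !gformNl !gformNr !opprK !JvL !gformL gform_JJ h1 (gformC h) h2.
by split; rewrite /m; field.
Qed.

(** * Local classification of umbilical charts *)

Section LocalShape.
Variables (R : realType) (n : nat).
Local Notation amb := 'rV[R]_(n.+1 + n.+1).
Local Notation par := 'rV[R]_(n + n).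
Local Notation J := (@Jv R n).
Local Notation g := (@gform R n).
Local Notation e := (@ee R n).
Hypothesis n1 : (1 < n)%N.

Definition umbilical_shape (S : set amb) :=
  (exists Z0 a b, (a, b) != (0, 0) /\ S = h_sphere Z0 a b) \/ holomorphic_hyperplane S.

(** Only pointwise conditions on an open domain are kept, so that they survive shrinking the domain;
    [H] is a parameter with the properties required of the mean curvature. *)
Definition umbilical_on (U : set par) (phi H : par -> amb) :=
  [/\ open U, smooth_on U phi & forall u, U u ->
    [/\ row_free (Tmx phi u), (Tmx phi u *m Jmx R n == Tmx phi u)%MS,
        \det (gram (Tmx phi u)) != 0, mxdiff H u /\ is_normal (Tmx phi u) (H u) &
        forall i j, normal_part (Tmx phi u) (d2 phi i j u) =
          g (row i (Tmx phi u)) (row j (Tmx phi u)) *: H u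
          - g (J (row i (Tmx phi u))) (row j (Tmx phi u)) *: J (H u)]].

Lemma umbilical_onS (U V : set par) phi H : open V -> V `<=` U ->
  umbilical_on U phi H -> umbilical_on V phi H.
Proof.
move=> oV VU [_ sm h]; split => //; first by move=> s x /VU; exact: sm.
by move=> u /VU; exact: h.
Qed.

Section UmbilicalChart.
Variables (U : set par) (phi H : par -> amb).
Hypothesis umbU : umbilical_on U phi H.

Lemma umbilical_open : open U. Proof. by case: umbU. Qed.
Lemma umbilical_smooth : smooth_on U phi. Proof. by case: umbU. Qed.
Lemma umbilical_free u : U u -> row_free (Tmx phi u).
Proof. by case: umbU => _ _ h /h []. Qed.
Lemma umbilical_J u : U u -> (Tmx phi u *m Jmx R n == Tmx phi u)%MS.
Proof. by case: umbU => _ _ h /h []. Qed.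
Lemma umbilical_gram u : U u -> \det (gram (Tmx phi u)) != 0.
Proof. by case: umbU => _ _ h /h []. Qed.
Lemma umbilical_mxdiff u : U u -> mxdiff H u.
Proof. by case: umbU => _ _ h /h [_ _ _ []]. Qed.
Lemma umbilical_normal u : U u -> is_normal (Tmx phi u) (H u).
Proof. by case: umbU => _ _ h /h [_ _ _ []]. Qed.
Lemma umbilical_d2 u i j : U u -> normal_part (Tmx phi u) (d2 phi i j u) =
  g (row i (Tmx phi u)) (row j (Tmx phi u)) *: H u
  - g (J (row i (Tmx phi u))) (row j (Tmx phi u)) *: J (H u).
Proof. by case: umbU => _ _ h /h []. Qed.

Lemma derive_phi u k : U u -> is_derive u (e k) phi (row k (Tmx phi u)).
Proof.
move=> Uu; rewrite row_Tmx; apply: is_derive_mxdiff.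
exact: (mxdiff_Diter umbilical_smooth [::]).
Qed.

Lemma derive_tangent u i k : U u -> is_derive u (e k) (fun w => row i (Tmx phi w)) (d2 phi k i u).
Proof.
move=> Uu; rewrite (_ : (fun w => _) = (fun w => derive phi w (e i))).
  by apply: is_derive_mxdiff; exact: (mxdiff_d1 umbilical_smooth).
by apply/funext => w; exact: row_Tmx.
Qed.

Lemma derive_d2 u i j k : U u ->
  is_derive u (e k) (d2 phi i j) (Diter [:: e k; e i; e j] phi u).
Proof. by move=> Uu; apply: is_derive_mxdiff; exact: (mxdiff_d2 umbilical_smooth). Qed.

Lemma derive_curvature u k : U u -> is_derive u (e k) H ('D_(e k) H u).
Proof. by move=> Uu; apply: is_derive_mxdiff; exact: umbilical_mxdiff. Qed.

Lemma derive_nor u v k : U u -> is_derive u (e k) (fun w => nor phi w v)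
  ('D_(e k) (fun w => nor phi w v) u).
Proof.
move=> Uu; apply: is_derive_mxdiff.
exact: (mxdiff_nor umbilical_smooth umbilical_gram Uu (mxdiff_cst v u)).
Qed.

Lemma umbilical_d2C u i j : U u -> d2 phi i j u = d2 phi j i u.
Proof. by move=> Uu; exact: (d2C umbilical_open umbilical_smooth). Qed.

Lemma umbilical_d3C u i j k : U u ->
  Diter [:: e k; e i; e j] phi u = Diter [:: e i; e k; e j] phi u.
Proof. by move=> Uu; exact: (Diter_comm umbilical_open umbilical_smooth [:: e j]). Qed.

Lemma curvature_derive0 u k : U u ->
  is_derive u (e k) (fun w => g (H w) (H w)) 0 /\
  is_derive u (e k) (fun w => g (J (H w)) (H w)) 0.
Proof.
exact: (gform_curvature_derive0 umbilical_open derive_tangent derive_d2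
  derive_curvature umbilical_d2C umbilical_d3C umbilical_free umbilical_gram
  umbilical_J umbilical_normal umbilical_d2 k n1).
Qed.

Lemma curvature_constant u0 (r : R) : ball u0 r `<=` U -> forall u, ball u0 r u ->
  g (H u) (H u) = g (H u0) (H u0) /\ g (J (H u)) (H u) = g (J (H u0)) (H u0).
Proof.
move=> BU u Bu; split.
- apply: (@partials0_constant _ _ (fun w => g (H w) (H w)) u0 r) => // y /BU Uy.
  have dH := umbilical_mxdiff Uy.
  split; first exact: differentiable_gform.
  by move=> k; have [[_ ->] _] := curvature_derive0 k Uy.
- apply: (@partials0_constant _ _ (fun w => g (J (H w)) (H w)) u0 r) => // y /BU Uy.
  have dH := umbilical_mxdiff Uy.
  split; first exact: differentiable_gform (mxdiff_Jv dH) dH.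
  by move=> k; have [_ [_ ->]] := curvature_derive0 k Uy.
Qed.

(** With [c] frozen at its value at [u0], the map [K = c phi + H] has derivative
    [c d_k phi + d_k H = 0], so [K / c] is a fixed centre. *)
Lemma local_sphere u0 (r : R) : ball u0 r `<=` U ->
  (g (H u0) (H u0), g (J (H u0)) (H u0)) != (0, 0) ->
  exists Z0 a b, (a, b) != (0, 0) /\ forall u, ball u0 r u -> h_sphere Z0 a b (phi u).
Proof.
move=> BU; set k1 := g (H u0) (H u0); set k2 := g (J (H u0)) (H u0) => k0.
pose m := k1 ^+ 2 + k2 ^+ 2.
have m0 : m != 0.
  apply: contraNneq k0 => /eqP; rewrite paddr_eq0 ?sqr_ge0 // !sqrf_eq0.
  by case/andP => /eqP -> /eqP ->.
pose K w := k1 *: phi w - k2 *: J (phi w) + H w.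
have Kc u : ball u0 r u -> K u = K u0.
  (* Multiplication by [c] becomes a constant matrix acting on the right, to which the product rules
     apply. *)
  have KE : K = (fun w => phi w *m (k1%:M - k2 *: Jmx R n) + H w).
    by apply/funext => w; rewrite /K mulmxBr mul_mx_scalar -scalemxAr.
  move: u; apply: partials0_constant_mx => y By; have Uy := BU _ By.
  rewrite KE; split.
    apply: mxdiffD (umbilical_mxdiff Uy).
    exact: mxdiff_mul (mxdiff_Diter umbilical_smooth [::] Uy) (mxdiff_cst _ _).
  move=> k.
  have [c1 c2] := curvature_constant BU By.
  have H0 : H y != 0.
    by apply: contraNneq k0 => Hy; rewrite /k1 /k2 -c1 -c2 Hy /Jv mul0mx !gform0l.
  have := is_deriveD (is_derive_mulmx (k1%:M - k2 *: Jmx R n) (derive_phi k Uy))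
    (derive_curvature k Uy).
  rewrite (dH_tangent umbilical_open derive_tangent derive_d2 derive_curvature
    umbilical_d2C umbilical_d3C umbilical_free umbilical_gram umbilical_J
    umbilical_normal umbilical_d2 k n1 Uy H0).
  rewrite c1 c2 mulmxBr mul_mx_scalar -scalemxAr /Jv.
  by rewrite addrA subrK subrr.
exists ((k1 / m) *: K u0 + (k2 / m) *: J (K u0)), (k1 / m), (- (k2 / m)); split.
  apply: contraNneq k0 => -[/eqP + /eqP]; rewrite oppr_eq0 !mulf_eq0 !invr_eq0 (negPf m0).
  by rewrite !orbF => /eqP -> /eqP ->.
move=> u Bu; rewrite -(Kc u Bu); have [c1 c2] := curvature_constant BU Bu.
exact: h_sphere_rescaled.
Qed.

Lemma nor_constant u0 (r : R) v : ball u0 r `<=` U ->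
  (forall u, U u -> H u = 0) -> forall u, ball u0 r u -> nor phi u v = nor phi u0 v.
Proof.
move=> BU H0; apply: partials0_constant_mx => y By; have Uy := BU _ By.
split; first exact: (mxdiff_nor umbilical_smooth umbilical_gram Uy (mxdiff_cst v y)).
move=> k; have := derive_nor v k Uy.
by rewrite (normal_part_derive0 umbilical_open derive_tangent umbilical_gram umbilical_d2
  (fun u w _ => norE phi u w) derive_nor v k H0 Uy).
Qed.

(** A vector normal at [u0] stays normal on the whole ball by [nor_constant], so its product with
    [phi] is constant. Hence [phi u - phi u0] is orthogonal to the normal space at [u0], that is,
    tangent. *)
Lemma local_plane u0 (r : R) : ball u0 r `<=` U -> 0 < r ->
  (forall u, U u -> H u = 0) ->
  forall u, ball u0 r u -> (phi u - phi u0 <= Tmx phi u0)%MS.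
Proof.
move=> BU r0 H0 u Bu.
have U0 : U u0 by apply: BU; exact: ballxx.
have orth v : g (phi u - phi u0) (nor phi u0 v) = 0.
  rewrite gformDl gformNl; apply/eqP; rewrite subr_eq0; apply/eqP.
  move: u Bu; apply: (@partials0_constant _ _ (fun w => g (phi w) (nor phi u0 v))).
  move=> y By; have Uy := BU _ By; split.
    exact: differentiable_gform (mxdiff_Diter umbilical_smooth [::] Uy) (mxdiff_cst _ _).
  move=> k.
  have [_ ->] := is_derive_gform (derive_phi k Uy) (is_derive_cst (nor phi u0 v) y (e k)).
  rewrite gform0r addr0 /= -(nor_constant v BU H0 By).
  exact: (nor_normal umbilical_gram v Uy).
have nx := normal_part_normal (umbilical_gram U0) (phi u - phi u0).
have [c E] := normal_partP (Tmx phi u0) (phi u - phi u0).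
apply/submxP; exists c; rewrite E.
rewrite [X in _ + X](normal_normal0 (umbilical_gram U0) nx) ?addr0 // => v nv.
have := orth v; rewrite norE.
rewrite -(gform_normal_part _ (normal_part_normal (umbilical_gram U0) v)) gformC.
by rewrite gform_normal_part.
Qed.

Lemma isotropic_curvature_eq0 u : U u ->
  g (H u) (H u) = 0 -> g (J (H u)) (H u) = 0 -> H u = 0.
Proof.
move=> Uu.
exact: (normal_isotropic0 umbilical_gram umbilical_J Uu (umbilical_normal Uu)).
Qed.

Lemma sphere_neq0 Z0 a b u : (forall w, U w -> h_sphere Z0 a b (phi w)) ->
  U u -> H u != 0.
Proof.
move=> hS Uu.
have hS1 w : U w -> g (phi w - Z0) (phi w - Z0) = a by move=> /hS [].
exact: (sphere_H_neq0 umbilical_open derive_tangent umbilical_gram umbilical_d2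
  derive_phi (ltnW n1) hS1 Uu).
Qed.

Lemma sphere_unique Z a b Z' a' b' u :
  (forall w, U w -> h_sphere Z a b (phi w)) ->
  (forall w, U w -> h_sphere Z' a' b' (phi w)) -> U u ->
  h_sphere Z a b = h_sphere Z' a' b'.
Proof.
move=> hS hS' Uu.
have hS1 w : U w -> g (phi w - Z) (phi w - Z) = a by move=> /hS [].
have hS1' w : U w -> g (phi w - Z') (phi w - Z') = a' by move=> /hS' [].
have EZ := sphere_center_unique umbilical_open derive_tangent umbilical_free
  umbilical_gram umbilical_J umbilical_normal umbilical_d2 derive_phi (ltnW n1) hS1 hS1' Uu.
by have [E1 E2] := hS _ Uu; have [E1' E2'] := hS' _ Uu; rewrite -E1 -E2 -E1' -E2' EZ.
Qed.

Lemma plane_eq0 S u : holomorphic_hyperplane S -> (forall w, U w -> S (phi w)) ->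
  U u -> H u = 0.
Proof.
move=> [Z0 [Wm [Wf _ _ ->]]] hS Uu.
have hW w : U w -> (phi w - Z0 <= Wm)%MS.
  by move=> /hS [c ->]; rewrite addrC addKr; exact: submxMl.
exact: (plane_H_eq0 umbilical_open derive_tangent umbilical_free umbilical_gram
  umbilical_d2 derive_phi (ltnW n1) Wf hW Uu).
Qed.

(** The right-hand side involves only the chart at [u], so two hyperplanes containing the same piece
    coincide. *)
Lemma plane_eq S u : holomorphic_hyperplane S -> (forall w, U w -> S (phi w)) ->
  U u -> S = [set Z | (Z - phi u <= Tmx phi u)%MS].
Proof.
move=> [Z0 [Wm [Wf _ _ ->]]] hS Uu.
have hW w : U w -> (phi w - Z0 <= Wm)%MS.
  by move=> /hS [c ->]; rewrite addrC addKr; exact: submxMl.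
have TW := plane_tangent umbilical_open umbilical_free derive_phi Wf hW Uu.
apply/seteqP; split => Z /=.
  move=> [c ->]; rewrite TW; have -> : Z0 + c *m Wm - phi u = c *m Wm - (phi u - Z0).
    by rewrite opprB addrA (addrC Z0).
  by rewrite addmx_sub ?submxMl // eqmx_opp hW.
rewrite TW => /(fun h => addmx_sub h (hW u Uu)).
by rewrite addrA subrK => /submxP [c E]; exists c; rewrite -E subrKC.
Qed.

End UmbilicalChart.

Lemma local_shape U phi H u0 : umbilical_on U phi H -> U u0 ->
  exists V S, [/\ open V, V u0, V `<=` U,
  umbilical_shape S & forall u, V u -> S (phi u)].
Proof.
move=> umbU U0.
have /nbhs_ballP [r /= r0 BU] : nbhs u0 U.
  by apply: open_nbhs_nbhs; split => //; exact: umbilical_open umbU.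
have oB : open (ball u0 r) by exact: ball_open.
have [c0|c0] := eqVneq (g (H u0) (H u0), g (J (H u0)) (H u0)) (0, 0); last first.
  have [Z0 [a [b [ab hS]]]] := local_sphere umbU BU c0.
  exists (ball u0 r), (h_sphere Z0 a b); split => //; first exact: ballxx.
  by left; exists Z0, a, b.
exists (ball u0 r), [set Z | exists c : par, Z = phi u0 + c *m Tmx phi u0].
split=> //; first exact: ballxx.
  right; exists (phi u0), (Tmx phi u0); split => //.
  - exact: umbilical_free umbU _ U0.
  - exact: umbilical_J umbU _ U0.
  - exact: umbilical_gram umbU _ U0.
have umbB := umbilical_onS oB BU umbU.
case: c0 => c01 c02.
(* [c] is constant on the ball and vanishes at its centre, so [H] is a normal vector with
   [G (H, H) = 0], hence zero. *)
have HB u : ball u0 r u -> H u = 0.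
  move=> Bu; have [E1 E2] := curvature_constant umbU BU Bu.
  by apply: (isotropic_curvature_eq0 umbB Bu); rewrite ?E1 ?E2.
move=> u Bu; have /submxP [c E] := local_plane umbB (@subset_refl _ _) r0 HB Bu.
by exists c; rewrite -E addrC subrK.
Qed.

Lemma shape_unique U phi H S S' u : umbilical_on U phi H -> U u ->
  umbilical_shape S -> umbilical_shape S' ->
  (forall w, U w -> S (phi w)) -> (forall w, U w -> S' (phi w)) -> S = S'.
Proof.
move=> umbU Uu [[Z [a [b [_ ->]]]]|pS] [[Z' [a' [b' [_ ->]]]]|pS'] hS hS'.
- exact: sphere_unique umbU _ _ _ _ _ _ _ hS hS' Uu.
- by have := sphere_neq0 umbU hS Uu; rewrite (plane_eq0 umbU pS' hS' Uu) eqxx.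
- by have := sphere_neq0 umbU hS' Uu; rewrite (plane_eq0 umbU pS hS Uu) eqxx.
- by rewrite (plane_eq umbU pS hS Uu) (plane_eq umbU pS' hS' Uu).
Qed.

Lemma sigma_ee phi u i j : sigma phi u (e i) (e j) = nor phi u (d2 phi i j u).
Proof.
rewrite /sigma (bigD1 i) //= [X in _ + X]big1 ?addr0 => [|k ki]; last first.
  by rewrite big1 // => l _; rewrite mxE (negPf ki) andbF mul0r scale0r.
rewrite (bigD1 j) //= [X in _ + X]big1 ?addr0 => [|l lj]; last first.
  by rewrite [X in _ * X]mxE (negPf lj) andbF mulr0 scale0r.
by rewrite !mxE !eqxx mulr1 scale1r.
Qed.

Lemma chart_umbilical M U W phi : holomorphic_hypersurface M -> h_umbilical M ->
  is_chart M U W phi -> umbilical_on U phi (Hmean phi).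
Proof.
move=> [_ hM] uM ch; have [oU [_ [smU [_ [_ [_ Tf]]]]]] := ch.
have Tg u : U u -> \det (gram (Tmx phi u)) != 0 by move=> Uu; case: (hM _ _ _ ch u Uu).
split => // u Uu; have [TJ _] := hM _ _ _ ch u Uu; split => //.
- exact: Tf.
- exact: Tg.
- split; [exact: mxdiff_Hmean smU Tg _ Uu | exact: Hmean_normal Tg _ Uu].
- by move=> i j; rewrite -norE -sigma_ee (uM _ _ _ ch u Uu) -!rowE.
Qed.

(** * Germs and the passage from local to global *)

Definition germ_in (M S : set amb) (p : amb) :=
  exists W, [/\ open W, W p & M `&` W `<=` S].

Lemma germ_in_open M S : open (germ_in M S).
Proof.
rewrite openE => p [W [oW Wp MW]].
have : nbhs p W by exact: open_nbhs_nbhs.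
by apply: filterS => q Wq; exists W.
Qed.

Section Global.
Variable M : set amb.
Hypothesis hM : holomorphic_hypersurface M.
Hypothesis uM : h_umbilical M.

Lemma germ_exists p : M p -> exists2 S, umbilical_shape S & germ_in M S p.
Proof.
move=> Mp; have [U [W [phi [ch Wp]]]] := hM.1 _ Mp.
have [oU [oW [_ [_ [im [hom _]]]]]] := ch.
have [u Uu pE] : (phi @` U) p by rewrite im.
have [V [S [oV Vu VU shS hS]]] := local_shape (chart_umbilical hM uM ch) Uu.
(* The chart is a homeomorphism onto its image, so the image of the smaller domain [V] is cut out of
   [M] by an open set. *)
exists S => //; have [W' [oW' im']] := hom V oV VU.
exists W'; split => //.
  by have [] : (M `&` W') p by rewrite -im'; exists u.
by rewrite -im' => _ [v Vv <-]; exact: hS.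
Qed.

Lemma germ_unique p S S' : M p -> umbilical_shape S -> umbilical_shape S' ->
  germ_in M S p -> germ_in M S' p -> S = S'.
Proof.
move=> Mp shS shS' [W1 [oW1 W1p MS]] [W2 [oW2 W2p MS']].
have [U [W [phi [ch Wp]]]] := hM.1 _ Mp.
have [oU [oW [smU [_ [im _]]]]] := ch.
have [u Uu pE] : (phi @` U) p by rewrite im.
(* The chart is shrunk until its image lies in both neighbourhoods; continuity of [phi] puts [u] in
   the interior. *)
pose V := interior (U `&` phi @^-1` (W1 `&` W2)).
have Vu : V u.
  rewrite /V /interior /=; apply: filterI; first exact: open_nbhs_nbhs.
  have cphi := differentiable_continuous (smU [::] u Uu).
  apply: cphi; apply: open_nbhs_nbhs; split; first exact: openI.
  by rewrite /= pE.
have oV : open V by exact: open_interior.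
have VS : V `<=` U `&` phi @^-1` (W1 `&` W2) by exact: interior_subset.
have inM w : V w -> M (phi w).
  by move=> /VS [Uw _]; have [] : (M `&` W) (phi w) by rewrite -im; exists w.
apply: (shape_unique (umbilical_onS oV _ (chart_umbilical hM uM ch)) Vu shS shS').
- by move=> w /VS [].
- by move=> w Vw; apply: MS; split; [exact: inM|have [_ []] := VS _ Vw].
- by move=> w Vw; apply: MS'; split; [exact: inM|have [_ []] := VS _ Vw].
Qed.

(** The points of [M] with germ in [S] form a relatively open set. By existence and uniqueness of
    the shape at each point, the rest of [M] is the trace of the open union over the other shapes,
    so connectedness leaves only [S]. *)
Lemma connected_shape p : connected M -> M p ->
  exists2 S, umbilical_shape S & M `<=` S.
Proof.
move=> cM Mp; have [S shS gS] := germ_exists Mp; exists S => //.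
suff E : M `&` germ_in M S = M.
  by move=> q Mq; rewrite -E in Mq; case: Mq => Mq [W [_ Wq]]; apply.
apply: cM; first by exists p.
  by exists (germ_in M S) => //; exact: germ_in_open.
exists (~` \bigcup_(S' in [set S' | umbilical_shape S' /\ S' <> S]) germ_in M S').
  by apply: open_closedC; apply: bigcup_open => S' _; exact: germ_in_open.
apply/seteqP; split => q [Mq gq]; split => //.
  by move=> [S' [shS' neS] gq']; apply: neS; exact: germ_unique gq' gq.
have [S' shS' gq'] := germ_exists Mq.
have [->|neS] := pselect (S = S'); first by [].
by case: gq; exists S' => //; split => // /esym.
Qed.

End Global.
End LocalShape.

Theorem theorem4p2 (R : realType) (n : nat) (M : set ('rV[R]_(n.+1 + n.+1))) :
  (3 <= n)%N ->
  connected M ->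
  holomorphic_hypersurface M ->
  h_umbilical M ->
  (exists (Z0 : 'rV[R]_(n.+1 + n.+1)) (a b : R), (a, b) != (0, 0) /\ M `<=` h_sphere Z0 a b) \/
  (exists P : set ('rV[R]_(n.+1 + n.+1)), holomorphic_hyperplane P /\ M `<=` P).
Proof.
move=> n3 cM hM uM.
have [->|/set0P [p Mp]] := eqVneq M set0.
  (* The empty set is also connected and lies in any h-sphere; [(1, 0)] is an admissible pair of
     parameters. *)
  by left; exists 0, 1, 0; split; [rewrite xpair_eqE oner_eq0|exact: sub0set].
have [S [[Z0 [a [b [ab ->]]]]|pS] MS] := connected_shape (ltnW n3) hM uM cM Mp.
- by left; exists Z0, a, b.
- by right; exists S.
Qed.
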